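(* Assume that $K:[0,\infty)\to\mathbb{R}\cup\{\infty\}$ satisfies the following hypotheses, where the interaction potential on $\mathbb{H}^n\times\mathbb{H}^n$ is $K(x,y)=K(d(x,y))$: 1. $K$ is bounded from below by a finite constant $K_{min}<0$. 2. $K$ is locally integrable, i.e. $\int_{d(x,v)<R}|K(d(x,v))|\,dx<\infty$ for any $R>0$. 3. The limit $K_\infty=\lim_{\theta\to\infty}K(\theta)$ exists and $K$ is unstable, i.e. there exists $\rho\in\mathcal{P}(\mathbb{H}^n)$ such that $E[\rho]<\frac12K_\infty$. 4. $K$ is lower semi-continuous. 5. There exists $R_6>0$ such that $K$ is strictly increasing on $[R_6,\infty)$. Let $R\ge0$ and suppose that $\rho_R$ is a global minimizer of the energy $E$ on $\mathcal{P}_R(\mathbb{H}^n)$. Then the support of $\rho_R$ cannot have gaps larger than $2R_6$ in each coordinate, in the following sense: if $k\in\{1,\dots,n\}$ and $a_k\in\mathbb{R}$ is such that $\pi_k^{-1}([a_k-R_6,a_k+R_6])\subseteq\mathbb{H}^n\setminus\operatorname{supp}(\rho_R)$, then either $\pi_k^{-1}((-\infty,a_k-R_6])\subseteq\mathbb{H}^n\setminus\operatorname{supp}(\rho_R)$ or $\pi_k^{-1}([a_k+R_6,\infty))\subseteq\mathbb{H}^n\setminus\operatorname{supp}(\rho_R)$.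
   Context: Hyperboloid model: $\mathbb{H}^n=\{x\in\mathbb{R}^{n+1}: -x_0^2+x_1^2+\dots+x_n^2=-1,\ x_0>0\}$, geodesic distance $d(x,y)=\cosh^{-1}(x_0y_0-x_1y_1-\cdots-x_ny_n)$, vertex $v=(1,0,\dots,0)$, canonical volume measure $dx$. $B_R(v)$ is the open geodesic ball of radius $R$ centred at $v$. $\mathcal{P}(\mathbb{H}^n)$ is the set of Borel probability measures on $\mathbb{H}^n$, and $\mathcal{P}_R(\mathbb{H}^n)=\{\rho\in\mathcal{P}(\mathbb{H}^n):\operatorname{supp}(\rho)\subset\overline{B_R(v)}\}$. The energy is $E[\rho]=\frac12\iint_{\mathbb{H}^n\times\mathbb{H}^n}K(d(x,y))\,d\rho(x)\,d\rho(y)\in\mathbb{R}\cup\{\infty\}$. For $k\in\{1,\dots,n\}$, $\pi_k:\mathbb{H}^n\to\mathbb{R}$ is the map $\pi_k(x)=\tanh^{-1}(x_k/x_0)$. *)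

(* Defs.v *)
From HB Require Import structures.
From mathcomp Require Import all_boot all_order all_algebra ring lra.
From mathcomp Require Import all_classical all_reals all_analysis measurable_realfun.

Set Implicit Arguments.
Unset Strict Implicit.
Unset Printing Implicit Defensive.

Import Order.TTheory GRing.Theory Num.Theory.
Import numFieldNormedType.Exports.

Local Open Scope classical_set_scope.
Local Open Scope ring_scope.

Section InverseHyperbolic.
Context {R : realType}.
Implicit Types x : R.

Definition cosh x : R := (expR x + expR (- x)) / 2.
Definition sinh x : R := (expR x - expR (- x)) / 2.
Definition tanh x : R := sinh x / cosh x.

Definition acosh x : R := ln (x + Num.sqrt (x ^+ 2 - 1)).
Definition atanh x : R := ln ((1 + x) / (1 - x)) / 2.

Lemma acosh_ge0 x : 1 <= x -> 0 <= acosh x.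
Proof. by move=> x1; rewrite ln_ge0// (le_trans x1)// lerDl sqrtr_ge0. Qed.

Lemma acoshK x : 1 <= x -> cosh (acosh x) = x.
Proof.
move=> x1; have x0 : 0 < x by rewrite (lt_le_trans ltr01).
have s0 : 0 <= x ^+ 2 - 1 by rewrite subr_ge0 exprn_ege1.
have p0 : 0 < x + Num.sqrt (x ^+ 2 - 1) by rewrite ltr_wpDr ?sqrtr_ge0.
have := sqr_sqrtr s0; rewrite /cosh /acosh expRN lnK ?posrE//.
move: (Num.sqrt _) p0 => s p0 ss.
have -> : (x + s)^-1 = x - s.
  by apply: (mulfI (lt0r_neq0 p0)); rewrite divff ?lt0r_neq0//; ring: ss.
by field.
Qed.

Lemma atanhK x : -1 < x < 1 -> tanh (atanh x) = x.
Proof.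
move=> /andP[xN1 x1]; have a0 : 0 < 1 + x by lra.
have b0 : 0 < 1 - x by lra.
set y := atanh x; have y2 : expR y ^+ 2 = (1 + x) / (1 - x).
  rewrite -expRM_natl /y /atanh mulrC divfK ?lnK ?posrE ?divr_gt0//.
have e0 := expR_gt0 y.
have -> : tanh y = (expR y ^+ 2 - 1) / (expR y ^+ 2 + 1).
  rewrite /tanh /sinh /cosh expRN; field.
  by rewrite !lt0r_neq0// addr_gt0// ?exprn_gt0.
rewrite y2; field.
by apply/andP; split; apply/eqP; lra.
Qed.

End InverseHyperbolic.

Section Hyperboloid.
Context (R : realType) (n : nat).

(* Coordinate 0 is the time-like one; the mathematical x_k, 1 <= k <= n, is
   coordinate [lift ord0 k] for k : 'I_n. *)
Definition hyperboloid_set : set 'rV[R]_n.+1 :=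
  [set x | - x ord0 ord0 ^+ 2 + \sum_(i < n) x ord0 (lift ord0 i) ^+ 2 = -1
           /\ 0 < x ord0 ord0].

Definition hyperboloid : Type := set_type hyperboloid_set.

HB.instance Definition _ :=
  Topological.copy hyperboloid (set_type hyperboloid_set).

Definition hcoord (x : hyperboloid) (i : 'I_n.+1) : R := set_val x ord0 i.

(* The hyperboloid as the graph of sqrt(1 + |t|^2) over R^n. *)
Definition hgraph_fun (t : n.-tuple R) : 'rV[R]_n.+1 :=
  \row_(i < n.+1) oapp (tnth t)
    (Num.sqrt (1 + \sum_(j < n) tnth t j ^+ 2)) (unlift ord0 i).

Lemma hgraph_subproof (t : n.-tuple R) : hgraph_fun t \in hyperboloid_set.
Proof.
have s0 : 0 <= \sum_(j < n) tnth t j ^+ 2 by apply: sumr_ge0 => j _; exact: sqr_ge0.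
apply/mem_set; rewrite /hyperboloid_set/= /hgraph_fun !mxE unlift_none/=; split; last first.
  by rewrite sqrtr_gt0 ltr_pwDl.
rewrite sqr_sqrtr ?addr_ge0//.
rewrite [X in _ + X](eq_bigr (fun j => tnth t j ^+ 2)); last first.
  by move=> j _; rewrite mxE liftK.
by rewrite opprD addrNK.
Qed.

Definition hgraph (t : n.-tuple R) : hyperboloid :=
  exist _ (hgraph_fun t) (hgraph_subproof t).

Definition vertex : hyperboloid := hgraph [tuple of nseq n 0].

HB.instance Definition _ := isPointed.Build hyperboloid vertex.

HB.instance Definition _ :=
  Measurable.copy hyperboloid (g_sigma_algebraType (@open hyperboloid)).

Lemma vertexE (i : 'I_n.+1) : hcoord vertex i = (i == ord0)%:R.
Proof.
rewrite /hcoord /vertex set_valE/= mxE.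
case: unliftP => [j ->|->]/=.
  by rewrite tnth_nseq.
rewrite big1 ?addr0 ?sqrtr1// => j _.
by rewrite tnth_nseq expr0n.
Qed.

End Hyperboloid.

(* The canonical sigma-finite structure on [\x] is the one for subprobability
   measures, which shadows this more general fact. *)
Lemma sigma_finite_prod d1 d2 (T1 : measurableType d1) (T2 : measurableType d2)
    (R : realType) (m1 : {sigma_finite_measure set T1 -> \bar R})
    (m2 : {sigma_finite_measure set T2 -> \bar R}) :
  sigma_finite setT (m1 \x m2)%E.
Proof.
have /sigma_finiteP[F [TF ndF Foo]] := sigma_finiteT m1.
have /sigma_finiteP[G [TG ndG Goo]] := sigma_finiteT m2.
exists (fun n => F n `*` G n).
  rewrite -setXTT TF TG predeqE => -[x y]; split.
    move=> [/= [n _ Fnx] [k _ Gky]]; exists (maxn n k) => //; split.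
    - by move: x Fnx; exact/subsetPset/ndF/leq_maxl.
    - by move: y Gky; exact/subsetPset/ndG/leq_maxr.
  by move=> [n _ []/= ? ?]; split; exists n.
move=> k; have [? ?] := Foo k; have [? ?] := Goo k.
split; first exact: measurableX.
by rewrite product_measure1E// lte_mul_pinfty// ge0_fin_numE.
Qed.

Section LebesgueTuple.
Context {R : realType}.
Local Open Scope ereal_scope.
Local Notation RT n := (n.-tuple (measurableTypeR R)).

Definition tuple_cons n (p : measurableTypeR R * RT n) : RT n.+1 :=
  [tuple of p.1 :: p.2].

(* n-dimensional Lebesgue measure, as an n-fold product *)
Fixpoint lebesgue_tuple n : set (RT n) -> \bar R :=
  match n with
  | 0 => dirac ([tuple] : RT 0)
  | n.+1 => pushforward (@lebesgue_measure R \x @lebesgue_tuple n)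
              (@tuple_cons n)
  end.

Lemma measurable_tuple_cons n : measurable_fun setT (@tuple_cons n).
Proof. exact: measurable_cons. Qed.

Section step.
Variables (n : nat) (m : {sigma_finite_measure set (RT n) -> \bar R}).

Let mS := pushforward (@lebesgue_measure R \x m) (@tuple_cons n).

Let mS0 : mS set0 = 0.
Proof. by rewrite /mS /pushforward preimage_set0 measure0. Qed.

Let mS_ge0 A : 0 <= mS A.
Proof. by rewrite /mS /pushforward measure_ge0. Qed.

Let mS_sigma_additive : semi_sigma_additive mS.
Proof.
have mf := @measurable_tuple_cons n.
move=> F mF tF mUF; rewrite /mS /pushforward preimage_bigcup.
apply: measure_semi_sigma_additive.
- by move=> k; rewrite -[X in measurable X]setTI; exact: mf.
- apply/trivIsetP => /= i j _ _ ij; rewrite -preimage_setI.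
  by move/trivIsetP : tF => /(_ _ _ _ _ ij) ->//; rewrite preimage_set0.
- by rewrite -preimage_bigcup -[X in measurable X]setTI; exact: mf.
Qed.

HB.instance Definition _ := isMeasure.Build _ _ _ mS
  mS0 mS_ge0 mS_sigma_additive.

Let mS_sigma_finite : sigma_finite setT mS.
Proof.
have [F FT Ffin] := sigma_finite_prod (@lebesgue_measure R) m.
pose split_ (t : RT n.+1) : measurableTypeR R * RT n :=
  (thead t, [tuple of behead t]).
have splitK : cancel (@tuple_cons n) split_.
  move=> [x t]; congr pair; apply: val_inj => //=.
have msplit : measurable_fun setT split_.
  by apply: measurable_fun_pair; [exact: measurable_tnth|exact: measurable_behead].
exists (fun k => split_ @^-1` (F k)).
  by rewrite -preimage_bigcup -FT preimage_setT.
move=> k; have [mFk Fk] := Ffin k; split.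
  by rewrite -[X in measurable X]setTI; exact: msplit.
rewrite /mS /pushforward/= (_ : _ @^-1` _ = F k)//.
by apply/funext => p; rewrite /preimage/= splitK.
Qed.

HB.instance Definition _ :=
  Measure_isSigmaFinite.Build _ _ _ mS mS_sigma_finite.

Definition lebesgue_tuple_step : {sigma_finite_measure set (RT n.+1) -> \bar R} :=
  mS.

End step.

Lemma lebesgue_tuple_measure n :
  exists mu : {sigma_finite_measure set (RT n) -> \bar R},
    mu = @lebesgue_tuple n :> (set (RT n) -> \bar R).
Proof.
elim: n => [|n [mu IH]]; first by exists (dirac ([tuple] : RT 0)).
by exists (lebesgue_tuple_step mu); rewrite /= -IH.
Qed.

Section canonical.
Variable n : nat.
Let mu := sval (cid (lebesgue_tuple_measure n)).
Let muE : @lebesgue_tuple n = mu.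
Proof. by rewrite /mu; case: cid. Qed.

Let lebesgue_tuple0 : @lebesgue_tuple n set0 = 0.
Proof. by rewrite muE measure0. Qed.

Let lebesgue_tuple_ge0 A : 0 <= @lebesgue_tuple n A.
Proof. by rewrite muE measure_ge0. Qed.

Let lebesgue_tuple_sigma_additive : semi_sigma_additive (@lebesgue_tuple n).
Proof. rewrite muE; exact: measure_semi_sigma_additive. Qed.

HB.instance Definition _ := isMeasure.Build _ _ _ (@lebesgue_tuple n)
  lebesgue_tuple0 lebesgue_tuple_ge0 lebesgue_tuple_sigma_additive.

Let lebesgue_tuple_sigma_finite : sigma_finite setT (@lebesgue_tuple n).
Proof. rewrite muE; exact: sigma_finiteT. Qed.

HB.instance Definition _ := Measure_isSigmaFinite.Build _ _ _
  (@lebesgue_tuple n) lebesgue_tuple_sigma_finite.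

End canonical.

End LebesgueTuple.

Section Volume.
Context (R : realType) (n : nat).
Local Open Scope ereal_scope.
Local Notation RT := (n.-tuple (measurableTypeR R)).

Definition hdensity (t : RT) : \bar R :=
  ((Num.sqrt (1 + \sum_(j < n) tnth t j ^+ 2)%R)^-1)%:E.

(* Riemannian volume: the metric induced on the graph of sqrt(1 + |t|^2) by the
   Minkowski form has determinant 1 / (1 + |t|^2) in the coordinates t. *)
Definition hvolume : set (hyperboloid R n) -> \bar R :=
  pushforward (fun A : set RT => \int[@lebesgue_tuple R n]_(t in A) hdensity t)
    (@hgraph R n : RT -> hyperboloid R n).

Let measurable_norm2 : measurable_fun [set: RT]
  (fun t : RT => (1 + \sum_(j < n) tnth t j ^+ 2)%R : measurableTypeR R).
Proof.
apply: measurable_funD => //; apply: measurable_sum => j.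
by apply: measurable_funX; exact: (@measurable_tnth _ (measurableTypeR R)).
Qed.

Let norm2_ge0 (t : RT) : (0 <= 1 + \sum_(j < n) tnth t j ^+ 2 :> R)%R.
Proof. by rewrite addr_ge0// sumr_ge0// => j _; exact: sqr_ge0. Qed.

Let hdensityE (t : RT) :
  hdensity t = ((1 + \sum_(j < n) tnth t j ^+ 2) `^ (- 2^-1))%:E.
Proof. by rewrite /hdensity powRN powR12_sqrt. Qed.

Lemma measurable_hdensity : measurable_fun [set: RT] hdensity.
Proof.
apply: (eq_measurable_fun (fun t : RT =>
  ((1 + \sum_(j < n) tnth t j ^+ 2)%R `^ (- 2^-1))%:E)) => [t _|].
  by rewrite hdensityE.
apply/measurable_EFinP.
apply: (measurableT_comp (measurable_powR _)); exact: measurable_norm2.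
Qed.

Lemma hdensity_ge0 (t : RT) : 0 <= hdensity t.
Proof. by rewrite lee_fin invr_ge0 sqrtr_ge0. Qed.

Lemma measurable_hgraph :
  measurable_fun [set: RT] (@hgraph R n : RT -> hyperboloid R n).
Proof.
have mcoord (i : 'I_n.+1) : measurable_fun [set: RT]
    (fun t : RT => hgraph_fun t ord0 i : measurableTypeR R).
  have [j ->|->] := unliftP ord0 i.
    apply: (eq_measurable_fun (fun t : RT => tnth t j)) => [t _|].
      by rewrite mxE liftK.
    exact: (@measurable_tnth _ (measurableTypeR R)).
  apply: (eq_measurable_fun (fun t : RT =>
      ((1 + \sum_(j < n) tnth t j ^+ 2)%R `^ 2^-1)%R)) => [t _|].
    by rewrite mxE unlift_none/= powR12_sqrt.
  apply: (measurableT_comp (measurable_powR _)); exact: measurable_norm2.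
apply: (@measurability _ _ _ _ _ _ (@open (hyperboloid R n))) => //.
move=> _ [U oU <-]; rewrite setTI.
have [V oV VU] : exists2 V : set 'rV[R]_n.+1, open V & set_val @^-1` V = U.
  by case: oU => V oV <-; exists V.
pose box (ab : 'rV[rat]_n.+1 * 'rV[rat]_n.+1) : set 'rV[R]_n.+1 :=
  [set x | forall i, (ratr (ab.1 ord0 i) < x ord0 i < ratr (ab.2 ord0 i))%R].
rewrite (_ : _ @^-1` U = \bigcup_ab
    if `[< box ab `<=` V >] then @hgraph_fun R n @^-1` box ab else set0).
  apply: countable_bigcupT_measurable => // ab; case: asboolP => // _.
  rewrite (_ : _ @^-1` _ = \bigcap_(i in [set: 'I_n.+1])
      ([set: RT] `&` (fun t : RT => hgraph_fun t ord0 i) @^-1`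
        `]ratr (ab.1 ord0 i), ratr (ab.2 ord0 i)[)).
    apply: fin_bigcap_measurable => // i _.
    by apply: mcoord => //; exact: measurable_itv.
  apply/seteqP; split => [t abt i _|t abt i].
    by split=> //=; rewrite in_itv/=; exact: abt.
  by have [_ /=] := abt i I; rewrite in_itv.
rewrite -VU; apply/seteqP; split => [t Vt|t [ab _]]; last first.
  by case: asboolP => // abV /abV.
have /open_nbhs_nbhs := conj oV Vt : open_nbhs (hgraph_fun t) V.
move=> [P Pt PV].
have /choice[ab abP] (i : 'I_n.+1) : exists ab : rat * rat,
    (ratr ab.1 < hgraph_fun t ord0 i < ratr ab.2)%R /\
    [set y | ratr ab.1 < y < ratr ab.2]%R `<=` P ord0 i.
  have /nbhs_ballP[_/posnumP[e] eP] := Pt ord0 i.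
  have [a] : exists a : rat, (ratr a : R) \in
      `](hgraph_fun t ord0 i - e%:num)%R, hgraph_fun t ord0 i[.
    by apply: rat_in_itvoo; rewrite ltrBlDr ltrDl.
  have [b] : exists b : rat, (ratr b : R) \in
      `]hgraph_fun t ord0 i, (hgraph_fun t ord0 i + e%:num)%R[.
    by apply: rat_in_itvoo; rewrite ltrDl.
  rewrite !in_itv/= => /andP[tb be] /andP[ea at_].
  exists (a, b); split=> /=; first by rewrite at_.
  move=> y /= /andP[ay yb]; apply: eP; rewrite /ball/= ltr_distlC.
  by rewrite (lt_trans ea ay) (lt_trans yb be).
exists (\row_i (ab i).1, \row_i (ab i).2) => //.
case: asboolP => [_ i|nV]; first by rewrite !mxE; have [+ _] := abP i; rewrite mxE.
exfalso; apply: nV => x /= xab; apply: PV => i j; rewrite ord1.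
by have [_] := abP j; apply; have := xab j; rewrite !mxE.
Qed.

Let hvolume0 : hvolume set0 = 0.
Proof. by rewrite /hvolume /pushforward preimage_set0 integral_set0. Qed.

Let hvolume_ge0 A : 0 <= hvolume A.
Proof. by apply: integral_ge0 => t _; exact: hdensity_ge0. Qed.

Let hvolume_sigma_additive : semi_sigma_additive hvolume.
Proof.
move=> F mF tF mUF; rewrite /hvolume /pushforward preimage_bigcup.
apply: (semi_sigma_additive_nng_induced measurable_hdensity hdensity_ge0).
- by move=> k; rewrite -[X in measurable X]setTI; exact: measurable_hgraph.
- apply/trivIsetP => /= i j _ _ ij; rewrite -preimage_setI.
  by move/trivIsetP : tF => /(_ _ _ _ _ ij) ->//; rewrite preimage_set0.
- by rewrite -preimage_bigcup -[X in measurable X]setTI; exact: measurable_hgraph.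
Qed.

HB.instance Definition _ := isMeasure.Build _ _ _ hvolume
  hvolume0 hvolume_ge0 hvolume_sigma_additive.

End Volume.

Section Energy.
Context {R : realType} {n : nat}.
Implicit Types (x y c : hyperboloid R n) (rho : probability (hyperboloid R n) R).

Definition hdist x y : R :=
  acosh
    (hcoord x ord0 * hcoord y ord0
     - \sum_(i < n) hcoord x (lift ord0 i) * hcoord y (lift ord0 i)).

Definition hball c (r : R) : set (hyperboloid R n) := [set x | hdist x c < r].

Definition hproj (k : 'I_n) x : R :=
  atanh (hcoord x (lift ord0 k) / hcoord x ord0).

Definition supp rho : set (hyperboloid R n) :=
  [set x | forall U, open U -> U x -> (0 < rho U)%E].

Definition prob_in_ball (r : R) : set (probability (hyperboloid R n) R) :=
  [set rho | supp rho `<=` closure (hball (vertex R n) r)].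

(* Only the values of K on [0, +oo[ matter since hdist >= 0. *)
Definition energy (K : R -> \bar R) rho : \bar R :=
  (2^-1%:E * \int[rho \x rho]_z K (hdist z.1 z.2))%E.

Definition energy_minimizer (K : R -> \bar R)
    (A : set (probability (hyperboloid R n) R)) rho : Prop :=
  A rho /\ forall nu, A nu -> (energy K rho <= energy K nu)%E.

End Energy.

(* Main.v *)
Require Import Defs.
From mathcomp Require Import all_boot all_order all_algebra.
From mathcomp Require Import all_classical all_reals all_analysis.
From mathcomp Require Import ring lra measurable_realfun.
Import Order.TTheory GRing.Theory Num.Theory.
Import numFieldNormedType.Exports.

Local Open Scope classical_set_scope.
Local Open Scope ring_scope.

(** Write [u = hproj k x] for the k-th projection of a point x. The boost by t
    along the k-th axis is an isometry of the hyperboloid which shifts u to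
    [u + t], and in polar coordinates around that axis
      [cosh (hdist x y) = rho_x rho_y cosh (u_x - u_y) - <x', y'>]
    where [rho_x >= 1] and the transverse part [x'] are not affected by the boost
    ([mink_polar], [boost]). Hence the distance is a strictly increasing function
    of [|u_x - u_y|], and is at least [|u_x - u_y|] ([mink_perp_ub]).

    Suppose that the support of the minimizer meets both sides of the gap. Of
    the two parts, take the one on the side of a opposite to the vertex
    (the right one if [a >= 0], the left one otherwise) and boost it by R6 towards
    the other. Its points have [|u| > R6], so the boost does not take them further
    from the vertex and the new measure still lives in the ball
    ([boost_inward]). Distances inside each part are unchanged, whereas distances
    between the two parts decrease and stay above R6, because the projections were
    more than [2 R6] apart. As K is strictly increasing beyond R6, the energy
    decreases strictly ([minimizer_no_split], [one_sided_support]), which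
    contradicts minimality, provided that the energy of the minimizer is finite.

    Finiteness comes from instability: some probability has finite energy, and its
    conditioning on a small neighbourhood of a point of its support, moved to the
    vertex by a Lorentz reflection, is a competitor of finite energy in the ball
    ([finite_energy_competitor]). This needs [r > 0]; if [r = 0] the open ball is
    empty and no probability has its support in its closure.

    The measure theory behind the strict inequality is that a probability on the
    hyperboloid gives measure zero to the complement of its support
    ([measure_supp_compl]), and that two functions with [g <= f] almost everywhere
    and [\int f <= \int g] finite agree almost everywhere ([ae_eq_integral_le]). *)

(** * Hyperbolic functions *)
Section Cosh.
Context {R : realType}.
Implicit Types s t x y : R.

Lemma cosh_gt0 t : 0 < cosh t.
Proof. by rewrite /cosh divr_gt0// addr_gt0// expR_gt0. Qed.

Lemma coshN t : cosh (- t) = cosh t.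
Proof. by rewrite /cosh opprK addrC. Qed.

Lemma cosh0 : cosh 0 = 1 :> R.
Proof. by rewrite /cosh oppr0 expR0; field. Qed.

Lemma cosh2_sinh2 t : cosh t ^+ 2 = 1 + sinh t ^+ 2.
Proof.
rewrite /cosh /sinh expRN; field; exact/lt0r_neq0/expR_gt0.
Qed.

Lemma coshD s t : cosh (s + t) = cosh s * cosh t + sinh s * sinh t.
Proof. by rewrite /cosh /sinh opprD !expRD; field. Qed.

Lemma sinhD s t : sinh (s + t) = sinh s * cosh t + cosh s * sinh t.
Proof. by rewrite /cosh /sinh opprD !expRD; field. Qed.

Lemma sinhN t : sinh (- t) = - sinh t.
Proof. by rewrite /sinh opprK; field. Qed.

Lemma coshB s t : cosh (s - t) = cosh s * cosh t - sinh s * sinh t.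
Proof. by rewrite coshD coshN sinhN mulrN. Qed.

Lemma sinh_gt0 t : (0 < sinh t) = (0 < t).
Proof.
by rewrite /sinh pmulr_lgt0 ?invr_gt0// subr_gt0 ltr_expR; lra.
Qed.

Lemma cosh_mono s t : 0 <= s -> s < t -> cosh s < cosh t.
Proof.
move=> s0 st; have t0 : 0 < t by exact: le_lt_trans st.
have es : 1 <= expR s by rewrite -expR0 ler_expR.
have et : expR s < expR t by rewrite ltr_expR.
have e0 : 0 < expR s by exact: expR_gt0.
have f0 : 0 < expR t by exact: expR_gt0.
rewrite -subr_gt0 /cosh !expRN.
have -> : (expR t + (expR t)^-1) / 2 - (expR s + (expR s)^-1) / 2 =
  (expR t - expR s) * (expR s * expR t - 1) / (2 * expR s * expR t).
  by field; rewrite !lt0r_neq0.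
apply: divr_gt0; last by rewrite !mulr_gt0.
apply: mulr_gt0; first by rewrite subr_gt0.
by rewrite subr_gt0; nra.
Qed.

Lemma cosh_normr t : cosh `|t| = cosh t.
Proof. by case: (ler0P t) => // _; rewrite coshN. Qed.

Lemma cosh_lt s t : `|s| < `|t| -> cosh s < cosh t.
Proof. by move=> st; rewrite -(cosh_normr s) -(cosh_normr t) cosh_mono. Qed.

Lemma cosh_le s t : `|s| <= `|t| -> cosh s <= cosh t.
Proof.
rewrite le_eqVlt => /predU1P[st|/cosh_lt/ltW//].
by rewrite -(cosh_normr s) st cosh_normr.
Qed.

Lemma cosh_ge1 t : 1 <= cosh t.
Proof. by rewrite -cosh0 cosh_le// normr0. Qed.

Lemma acosh_ltl x s : 1 <= x -> 0 <= s -> (acosh x < s) = (x < cosh s).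
Proof.
move=> x1 s0; have a0 := acosh_ge0 x1; apply/idP/idP => [/cosh_mono|].
  by rewrite acoshK//; apply.
apply: contraTT; rewrite -!leNgt -{2}(acoshK x1) => ?.
by rewrite cosh_le// !ger0_norm.
Qed.

Lemma acosh_lt x y : 1 <= x -> x < y -> acosh x < acosh y.
Proof.
move=> x1 xy; have y1 : 1 <= y by apply: le_trans x1 (ltW xy).
by rewrite acosh_ltl ?acosh_ge0// acoshK.
Qed.

End Cosh.

(** * The Minkowski form and polar coordinates around an axis *)
Section Minkowski.
Context {R : realType} {n : nat}.
Local Notation H := (hyperboloid R n).
Implicit Types x y z : H.

(** The Minkowski product with the sign that makes it positive on the
    hyperboloid, so that [hdist x y] is [acosh (mink x y)]. *)
Definition mink x y : R :=
  hcoord x ord0 * hcoord y ord0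
  - \sum_(i < n) hcoord x (lift ord0 i) * hcoord y (lift ord0 i).

Lemma minkC x y : mink x y = mink y x.
Proof.
by rewrite /mink mulrC; congr (_ - _); apply: eq_bigr => i _; exact: mulrC.
Qed.

Lemma hcoord0_gt0 x : 0 < hcoord x ord0.
Proof. by case: x => x xP; have [_] := set_mem xP. Qed.

Lemma mink_xx x : mink x x = 1.
Proof.
case: x => x xP; have [xE _] := set_mem xP.
rewrite /mink /hcoord set_valE/= -expr2; under eq_bigr do rewrite -expr2.
by move: xE => /= xE; lra.
Qed.

Lemma mem_hyperboloid (w : 'rV[R]_n.+1) :
  w ord0 ord0 * w ord0 ord0
    - \sum_(i < n) w ord0 (lift ord0 i) * w ord0 (lift ord0 i) = 1 ->
  0 < w ord0 ord0 -> w \in @hyperboloid_set R n.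
Proof.
move=> E w0; apply/mem_set; split=> //.
by rewrite expr2; under eq_bigr do rewrite expr2; lra.
Qed.

Lemma mink_vertexr x : mink x (vertex R n) = hcoord x ord0.
Proof.
rewrite /mink vertexE eqxx mulr1 big1 ?subr0// => i _.
by rewrite vertexE mulr0.
Qed.

(** Reversed Cauchy-Schwarz inequality. It follows from
    [0 <= \sum_i (b f_i - a g_i)^2] and [2 a b <= a^2 + b^2]. *)
Lemma reverse_cauchy (I : finType) (P : pred I) (f g : I -> R) (a b : R) :
  0 < a -> 0 < b ->
  a ^+ 2 = 1 + \sum_(i | P i) f i ^+ 2 -> b ^+ 2 = 1 + \sum_(i | P i) g i ^+ 2 ->
  1 <= a * b - \sum_(i | P i) f i * g i.
Proof.
move=> a0 b0 aE bE; set s := \sum_(i | P i) f i * g i.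
have : 0 <= \sum_(i | P i) (b * f i - a * g i) ^+ 2.
  by apply: sumr_ge0 => i _; exact: sqr_ge0.
have -> : \sum_(i | P i) (b * f i - a * g i) ^+ 2 =
  b ^+ 2 * (\sum_(i | P i) f i ^+ 2) - 2 * a * b * s
  + a ^+ 2 * (\sum_(i | P i) g i ^+ 2).
  rewrite /s !mulr_sumr -sumrB -big_split/=.
  by apply: eq_bigr => i _; ring.
have -> : \sum_(i | P i) f i ^+ 2 = a ^+ 2 - 1 by rewrite aE; ring.
have -> : \sum_(i | P i) g i ^+ 2 = b ^+ 2 - 1 by rewrite bE; ring.
move=> h; have ab : 0 < a * b by rewrite mulr_gt0.
rewrite lerBrDr -(ler_pM2l ab); have := sqr_ge0 (a - b); nra.
Qed.

Lemma hcoord0_sqr x :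
  hcoord x ord0 ^+ 2 = 1 + \sum_(i < n) hcoord x (lift ord0 i) ^+ 2.
Proof.
have := mink_xx x; rewrite /mink; under eq_bigr do rewrite -expr2.
by rewrite -expr2 => E; lra.
Qed.

Lemma mink_ge1 x y : 1 <= mink x y.
Proof.
by apply: reverse_cauchy; rewrite ?hcoord0_gt0// hcoord0_sqr.
Qed.

Lemma hdistE x y : hdist x y = acosh (mink x y). Proof. by []. Qed.

Lemma hdist_ge0 x y : 0 <= hdist x y.
Proof. by rewrite hdistE acosh_ge0// mink_ge1. Qed.

Lemma hballE (r : R) : 0 <= r ->
  hball (vertex R n) r = [set x | hcoord x ord0 < cosh r].
Proof.
move=> r0; apply/seteqP; split=> x /=;
  by rewrite /hball/= hdistE acosh_ltl ?mink_ge1// mink_vertexr.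
Qed.

(** Polar coordinates around the geodesic axis of the k-th coordinate: with
    [u = hproj k x], the point x has [x_0 = hrad k x * cosh u] and
    [x_k = hrad k x * sinh u]. The radial factor is the square root of
    [1 + \sum_(i != k) x_i ^ 2], see [hrad_sqr]. *)
Definition hrad (k : 'I_n) x : R := hcoord x ord0 / cosh (hproj k x).

(** The part of the Minkowski product that a boost along the k-th axis leaves
    unchanged. *)
Definition mink_perp (k : 'I_n) x y : R :=
  \sum_(i < n | i != k) hcoord x (lift ord0 i) * hcoord y (lift ord0 i).

Lemma hrad_gt0 k x : 0 < hrad k x.
Proof. by rewrite /hrad divr_gt0 ?hcoord0_gt0 ?cosh_gt0. Qed.

Lemma hcoord0_polar k x : hcoord x ord0 = hrad k x * cosh (hproj k x).
Proof. by rewrite /hrad divfK// lt0r_neq0// cosh_gt0. Qed.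

Lemma hcoordk_polar k x :
  hcoord x (lift ord0 k) = hrad k x * sinh (hproj k x).
Proof.
have x0 := hcoord0_gt0 x.
have : -1 < hcoord x (lift ord0 k) / hcoord x ord0 < 1.
  have s2 : hcoord x (lift ord0 k) ^+ 2 < hcoord x ord0 ^+ 2.
    rewrite hcoord0_sqr (bigD1 k)//= addrCA ltrDl.
    by rewrite ltr_pwDl// sumr_ge0// => i _; exact: sqr_ge0.
  by rewrite ltr_pdivlMr// ltr_pdivrMr//; apply/andP; split; nra.
move=> /atanhK; rewrite -/(hproj k x) /tanh /hrad => /esym E.
rewrite mulrAC -mulrA -E mulrC divfK//; exact: lt0r_neq0.
Qed.

Lemma hrad_sqr k x :
  hrad k x ^+ 2 = 1 + \sum_(i < n | i != k) hcoord x (lift ord0 i) ^+ 2.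
Proof.
have := hcoord0_sqr x; rewrite (bigD1 k)//= hcoordk_polar (hcoord0_polar k).
have c := cosh2_sinh2 (hproj k x) => E.
have -> : hrad k x ^+ 2 = (hrad k x * cosh (hproj k x)) ^+ 2
    - (hrad k x * sinh (hproj k x)) ^+ 2.
  by rewrite [X in _ = X - _]exprMn [X in _ = _ - X]exprMn c; ring.
by rewrite E; ring.
Qed.

Lemma mink_polar k x y : mink x y =
  hrad k x * hrad k y * cosh (hproj k x - hproj k y) - mink_perp k x y.
Proof.
rewrite /mink (bigD1 k)//= -/(mink_perp k x y) !hcoordk_polar !(hcoord0_polar k).
by rewrite coshB; ring.
Qed.

Lemma hrad_mink_perp_ge1 k x y : 1 <= hrad k x * hrad k y - mink_perp k x y.
Proof. by apply: reverse_cauchy; rewrite ?hrad_gt0 ?hrad_sqr. Qed.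

(** For t the difference of the k-th projections this says that [hproj k] is
    1-Lipschitz for the hyperbolic distance. *)
Lemma mink_perp_ub k x y t :
  cosh t <= hrad k x * hrad k y * cosh t - mink_perp k x y.
Proof.
have h := hrad_mink_perp_ge1 k x y; have c := cosh_ge1 t.
have xy : 1 <= hrad k x * hrad k y.
  have h2 u : 1 <= hrad k u.
    have h0 := hrad_gt0 k u.
    suff : 1 <= hrad k u ^+ 2 by nra.
    by rewrite hrad_sqr lerDl sumr_ge0// => i _; exact: sqr_ge0.
  by rewrite -[1]mul1r; apply: ler_pM.
nra.
Qed.

End Minkowski.

(** * Isometries of the hyperboloid *)
Section ContinuousOperations.
Context {R : realType} {T : topologicalType}.
Implicit Types (f g : T -> R).

Lemma continuous_subr f g :
  continuous f -> continuous g -> continuous (fun x => f x - g x).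
Proof. by move=> cf cg x; apply: cvgB; [exact: cf|exact: cg]. Qed.

Lemma continuous_addr (V : normedModType R) (f g : T -> V) :
  continuous f -> continuous g -> continuous (fun x => f x + g x).
Proof. by move=> cf cg x; apply: cvgD; [exact: cf|exact: cg]. Qed.

Lemma continuous_mulr_cst f (c : R) :
  continuous f -> continuous (fun x => f x * c).
Proof. by move=> cf x; apply: cvgM; [exact: cf|exact: cvg_cst]. Qed.

Lemma continuous_scaler_cst (V : normedModType R) f (v : V) :
  continuous f -> continuous (fun x => f x *: v).
Proof. by move=> cf x; apply: cvgZr_tmp; exact: cf. Qed.

Lemma continuous_sumr (I : finType) (f : I -> T -> R) :
  (forall i, continuous (f i)) -> continuous (fun x => \sum_i f i x).
Proof.
by move=> cf; apply: continuous_big => [|i _]; [exact: add_continuous|exact: cf].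
Qed.

End ContinuousOperations.

Section Isometries.
Context {R : realType} {n : nat}.
Local Notation H := (hyperboloid R n).
Implicit Types x y z : H.

Lemma continuous_set_val : continuous (set_val : H -> 'rV[R]_n.+1).
Proof. exact: initial_continuous. Qed.

Lemma continuous_hcoord i : continuous ((@hcoord R n)^~ i).
Proof.
move=> x; apply: (@continuous_comp _ _ _ set_val (fun w : 'rV[R]_n.+1 => w ord0 i)).
  exact: continuous_set_val.
exact: coord_continuous.
Qed.

(** The bilinear form extending [mink] to the ambient space. *)
Definition mform (u v : 'rV[R]_n.+1) : R :=
  u ord0 ord0 * v ord0 ord0
  - \sum_(i < n) u ord0 (lift ord0 i) * v ord0 (lift ord0 i).

Lemma mformE x y : mform (set_val x) (set_val y) = mink x y. Proof. by []. Qed.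

Lemma mformC u v : mform u v = mform v u.
Proof.
by rewrite /mform mulrC; congr (_ - _); apply: eq_bigr => i _; exact: mulrC.
Qed.

Lemma mformDZl a u w v : mform (u + a *: w) v = mform u v + a * mform w v.
Proof.
rewrite /mform mulrBr mulr_sumr !mxE.
under eq_bigr do rewrite !mxE mulrDl.
rewrite big_split/=; under [X in _ - (_ + X)]eq_bigr do rewrite -mulrA.
by ring.
Qed.

Lemma mformDZ a b u u' w w' : mform (u + a *: w) (u' + b *: w') =
  mform u u' + a * mform w u' + b * mform u w' + a * b * mform w w'.
Proof.
rewrite mformDZl !(mformC _ (u' + _)) !mformDZl !(mformC u') !(mformC w').
by ring.
Qed.

(** A continuous map into the ambient space corestricts to the hyperboloid when
    its values lie on the upper sheet. *)
Lemma hyperboloid_map (f : H -> 'rV[R]_n.+1) : continuous f ->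
    (forall x, mform (f x) (f x) = 1) -> (forall x, 0 < f x ord0 ord0) ->
  exists2 F : H -> H, continuous F & forall x, set_val (F x) = f x.
Proof.
move=> cf fE f0.
exists (fun x => exist _ (f x) (mem_hyperboloid _ (fE x) (f0 x))) => //.
exact: (@continuous_comp_initial _ _ _ (set_val : H -> 'rV[R]_n.+1)).
Qed.

Lemma continuous_mink c : continuous ((@mink R n)^~ c).
Proof.
apply: continuous_subr.
  exact/continuous_mulr_cst/continuous_hcoord.
apply: continuous_sumr => i; exact/continuous_mulr_cst/continuous_hcoord.
Qed.

(** The Lorentz reflection along [c - v] exchanges c with the vertex v. When c
    already has height 1, it is the vertex and the identity is used. *)
Lemma reflection_to_vertex c : exists F : H -> H,
  [/\ continuous F, forall x y, mink (F x) (F y) = mink x y &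
      hcoord (F c) ord0 = 1].
Proof.
have [c1|c1] := eqVneq (hcoord c ord0) 1.
  by exists id; split=> // x; exact: cvg_id.
pose w := set_val c - set_val (vertex R n).
(* [a x] is [-2 <x, w> / <w, w>] for the Lorentzian form [<.,.> = - mform],
   since [<x, w> = hcoord x ord0 - mink x c] and [<w, w> = 2 (c_0 - 1)]. *)
pose a x := (mink x c - hcoord x ord0) / (hcoord c ord0 - 1).
pose f x := set_val x + a x *: w.
have d0 : hcoord c ord0 - 1 != 0 by rewrite subr_eq0.
have wE : w = set_val c + (-1) *: set_val (vertex R n) by rewrite scaleN1r.
have xw x : mform (set_val x) w = mink x c - hcoord x ord0.
  by rewrite mformC wE mformDZl !(mformC _ (set_val x)) !mformE mink_vertexr; ring.
have ww : mform w w = - 2 * (hcoord c ord0 - 1).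
  rewrite {1}wE mformDZl xw mink_xx xw minkC mink_vertexr vertexE eqxx/=; ring.
have fE x y : mform (f x) (f y) = mink x y.
  rewrite mformDZ mformE ww (mformC w) !xw /a; field.
  by [].
have f0 x : f x ord0 ord0 = mink x c.
  have v0 : set_val (vertex R n) ord0 ord0 = 1.
    by rewrite -[LHS]/(hcoord _ _) vertexE.
  have -> : f x ord0 ord0 = hcoord x ord0
      + a x * (hcoord c ord0 - set_val (vertex R n) ord0 ord0).
    by rewrite /f /w; move: (set_val (vertex R n)) => u; rewrite !mxE.
  by rewrite v0 /a; field.
have cf : continuous f.
  apply: continuous_addr; first exact: continuous_set_val.
  apply: continuous_scaler_cst; apply: continuous_mulr_cst.
  by apply: continuous_subr; [exact: continuous_mink|exact: continuous_hcoord].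
have [||F cF FE] := hyperboloid_map _ cf.
- by move=> x; rewrite fE mink_xx.
- by move=> x; rewrite f0 (lt_le_trans ltr01)// mink_ge1.
exists F; split=> //.
  by move=> x y; rewrite -mformE !FE fE.
by rewrite /hcoord FE f0 mink_xx.
Qed.

(** The boost along the k-th axis adds t to [hproj k] and fixes the other polar
    coordinates; the last two clauses record its effect on the height and on
    the Minkowski product with a point that is not moved. *)
Lemma boost (k : 'I_n) (t : R) : exists F : H -> H,
  [/\ continuous F, forall x y, mink (F x) (F y) = mink x y,
      forall x, hcoord (F x) ord0 = hrad k x * cosh (hproj k x + t) &
      forall x y, mink (F x) y =
        hrad k x * hrad k y * cosh (hproj k x + t - hproj k y) - mink_perp k x y].
Proof.
pose a x := hcoord x ord0 * (cosh t - 1) + hcoord x (lift ord0 k) * sinh t.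
pose b x := hcoord x ord0 * sinh t + hcoord x (lift ord0 k) * (cosh t - 1).
pose f x := set_val x + a x *: delta_mx 0 ord0 + b x *: delta_mx 0 (lift ord0 k).
have f0 x : f x ord0 ord0 = hrad k x * cosh (hproj k x + t).
  rewrite /f !mxE eqxx/= -!/(hcoord _ _) /a (hcoord0_polar k) hcoordk_polar coshD.
  by ring.
have fk x : f x ord0 (lift ord0 k) = hrad k x * sinh (hproj k x + t).
  rewrite /f !mxE !eqxx/= -!/(hcoord _ _) /b (hcoord0_polar k) hcoordk_polar sinhD.
  by ring.
have fi x i : i != k -> f x ord0 (lift ord0 i) = hcoord x (lift ord0 i).
  move=> ik; rewrite /f !mxE eqxx/= -!/(hcoord _ _) (inj_eq (@lift_inj _ ord0)).
  by rewrite (negbTE ik)/= !mulr0 !addr0.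
have fE x y : mform (f x) (f y) = mink x y.
  rewrite /mform (bigD1 k)//= !f0 !fk (mink_polar k) /mink_perp.
  under eq_bigr do rewrite !fi//.
  have -> : hproj k x - hproj k y = hproj k x + t - (hproj k y + t) by ring.
  by rewrite coshB; ring.
have cf : continuous f.
  apply: continuous_addr; first apply: continuous_addr.
  - exact: continuous_set_val.
  - apply: continuous_scaler_cst; apply: continuous_addr;
      by apply: continuous_mulr_cst; exact: continuous_hcoord.
  - apply: continuous_scaler_cst; apply: continuous_addr;
      by apply: continuous_mulr_cst; exact: continuous_hcoord.
have [||F cF FE] := hyperboloid_map _ cf.
- by move=> x; rewrite fE mink_xx.
- by move=> x; rewrite f0 mulr_gt0 ?hrad_gt0 ?cosh_gt0.
exists F; split=> //.
- by move=> x y; rewrite -mformE !FE fE.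
- by move=> x; rewrite /hcoord FE f0.
move=> x y; rewrite -mformE FE /mform (bigD1 k)//= f0 fk -!/(hcoord y _).
rewrite (hcoord0_polar k y) (hcoordk_polar k y) coshB /mink_perp.
under eq_bigr do rewrite fi//.
by rewrite -!/(hcoord y _); ring.
Qed.

End Isometries.

(** * Product integrals against image and conditional measures *)
Section PushforwardIntegral.
Local Open Scope ereal_scope.
Context {d d'} {X : measurableType d} {Y : measurableType d'} {R : realType}.

(** Change of variables for any measurable integrand, both sides being the
    difference of the integrals of the positive and negative parts. *)
Lemma integral_pushforward_measurable (mu : {measure set X -> \bar R})
    (T : X -> Y) (mT : measurable_fun setT T) (f : Y -> \bar R) :
  measurable_fun setT f ->
  \int[pushforward mu T]_y f y = \int[mu]_x f (T x).
Proof.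
move=> mf; pose m' : {measure set Y -> \bar R} :=
  measure_function_pushforward__canonical__measure_function_Measure mu mT.
transitivity (\int[m']_y f y) => //.
rewrite (integralE m' _ f) (integralE mu _ (fun x => f (T x))); congr (_ - _).
  rewrite ge0_integral_pushforward//; last exact: measurable_funepos.
  by rewrite preimage_setT; apply: eq_integral => x _; rewrite /= ?funeposE ?funenegE.
rewrite ge0_integral_pushforward//; last exact: measurable_funeneg.
by rewrite preimage_setT; apply: eq_integral => x _; rewrite /= ?funeposE ?funenegE.
Qed.

End PushforwardIntegral.

Section PushforwardProbability.
Local Open Scope ereal_scope.
Context {d d'} {X : measurableType d} {Y : measurableType d'} {R : realType}.

Lemma measurable_fun_map_pair (T : X -> Y) : measurable_fun setT T ->
  measurable_fun setT (fun z : X * X => (T z.1, T z.2)).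
Proof.
move=> mT; apply: measurable_fun_pair; apply: measurableT_comp => //.
Qed.

(** The image of a probability, with the change of variables formula for its
    square. *)
Lemma pushforward_probability (rho : probability X R) (T : X -> Y) :
  measurable_fun setT T ->
  exists nu : probability Y R,
    (forall A, nu A = rho (T @^-1` A)) /\
    forall f : Y * Y -> \bar R, measurable_fun setT f ->
      \int[nu \x nu]_z f z = \int[rho \x rho]_z f (T z.1, T z.2).
Proof.
move=> mT; pose T' : {mfun X >-> Y} := mfun_Sub (mem_set mT).
exists (distribution rho T'); split=> // f mf.
have mTT := measurable_fun_map_pair _ mT.
rewrite -(integral_pushforward_measurable _ _ mTT)//.
pose m' : {measure set (Y * Y) -> \bar R} :=
  measure_function_pushforward__canonical__measure_function_Measure (rho \x rho) mTT.
apply: (@eq_measure_integral _ _ _ setT m') => A mA _.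
apply: (product_measure_unique (m' := m')) => // B C mB mC.
have := mT measurableT B mB; rewrite setTI => mTB.
have := mT measurableT C mC; rewrite setTI => mTC.
transitivity ((rho \x rho) ((T @^-1` B) `*` (T @^-1` C))) => //.
by rewrite product_measure1E.
Qed.

(** Conditioning rho on U multiplies double integrals of nonnegative functions
    by at most [(rho U)^-2]. *)
Lemma integral_conditional (rho : probability X R) (U : set X)
    (f : X * X -> \bar R) :
  measurable U -> 0 < rho U -> measurable_fun setT f -> (forall z, 0 <= f z) ->
  exists2 nu : probability X R, nu (~` U) = 0 &
    \int[nu \x nu]_z f z <= ((fine (rho U))^-1 ^+ 2)%:E * \int[rho \x rho]_z f z.
Proof.
move=> mU U0 mf f0; have rU : rho U \is a fin_num by exact: fin_num_measure.
have rU0 : (0 < fine (rho U))%R by rewrite fine_gt0// U0 ltey_eq rU.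
pose nu : probability X R := mnormalize (mrestr rho mU) rho.
have nuE A : nu A = rho (A `&` U) * (fine (rho U))^-1%:E.
  rewrite /nu/= /mnormalize/= /mrestr setTI.
  by rewrite (gt_eqF U0) (lt_eqF (_ : rho U < +oo)) ?ltey_eq ?rU.
exists nu; first by rewrite nuE setICl measure0 mul0e.
have c0 : (0 <= (fine (rho U))^-1 ^+ 2)%R by rewrite sqr_ge0.
have mUU : measurable (U `*` U) by exact: measurableX.
pose m' : {measure set (X * X) -> \bar R} :=
  mscale (NngNum c0) (mrestr (rho \x rho) mUU).
have -> : \int[nu \x nu]_z f z = \int[m']_z f z.
  apply: eq_measure_integral => A mA _.
  apply: (product_measure_unique (m' := m')) => //= B C mB mC.
  rewrite /mscale/= /mrestr -setXI.
  rewrite product_measure1E; [|exact: measurableI|exact: measurableI].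
  rewrite !nuE expr2 EFinM.
  by rewrite [RHS]muleACA [RHS]muleC.
rewrite -(@ge0_integral_mscale _ _ _ (rho \x rho) _ measurableT (NngNum c0) f mf)//.
apply: ge0_le_measure_integral => // A mA.
rewrite /m' /mscale/= lee_pmul2l ?lte_fin ?exprn_gt0 ?invr_gt0//.
rewrite -[leLHS]/((rho \x rho) (A `&` U `*` U)).
apply: (@le_measure _ _ _ (rho \x rho)); [|by rewrite inE|exact: subIsetl].
by rewrite inE; exact: measurableI.
Qed.
End PushforwardProbability.

(** * Borel sets and supports on the hyperboloid *)
Section BorelHyperboloid.
Context {R : realType} {n : nat}.
Local Notation H := (hyperboloid R n).
Implicit Types (x y z : H) (rho : probability H R) (U : set H).

Lemma open_measurable_hyperboloid U : open U -> measurable U.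
Proof. exact: sub_sigma_algebra. Qed.

Lemma continuous_measurable_hyperboloid (F : H -> H) :
  continuous F -> measurable_fun setT F.
Proof.
move=> /continuousP cF.
apply: (@measurability _ _ _ _ _ _ (@open (hyperboloid R n))) => //.
move=> _ [U oU <-]; rewrite setTI.
exact: (open_measurable_hyperboloid _ (cF U oU)).
Qed.

Lemma continuous_measurable_real (f : H -> R) :
  continuous f -> measurable_fun setT (f : H -> measurableTypeR R).
Proof.
move=> /continuousP cf; apply: (measurability _ (RGenOpens.measurableE R)).
move=> _ [_ [a [b ->] <-]]; rewrite setTI.
by apply: open_measurable_hyperboloid; apply: cf; apply: interval_open.
Qed.

Lemma open_halfspace (f : H -> R) : continuous f -> open [set x | 0 < f x].
Proof.
move=> /continuousP cf; rewrite (_ : [set x | _] = f @^-1` `]0, +oo[).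
  by apply: cf; apply: interval_open.
by apply/seteqP; split=> x /=; rewrite in_itv/= andbT.
Qed.

Lemma measurable_hdist :
  measurable_fun setT (fun z : H * H => hdist z.1 z.2 : measurableTypeR R).
Proof.
have mc i : measurable_fun setT (fun x : H => hcoord x i : measurableTypeR R).
  by apply: continuous_measurable_real; exact: continuous_hcoord.
have mm : measurable_fun setT (fun z : H * H => mink z.1 z.2 : measurableTypeR R).
  apply: measurable_funB.
    by apply: measurable_funM; apply: (measurableT_comp (mc _)).
  apply: measurable_sum => i.
  by apply: measurable_funM; apply: (measurableT_comp (mc _)).
apply: (measurableT_comp (@measurable_ln R)); apply: measurable_funD => //.
apply: (eq_measurable_fun (fun z : H * H =>
    ((mink z.1 z.2 ^+ 2 - 1) `^ 2^-1 : measurableTypeR R))).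
  move=> z _; rewrite powR12_sqrt// subr_ge0 exprn_ege1//; exact: mink_ge1.
apply: (measurableT_comp (measurable_powR _)).
by apply: measurable_funB => //; apply: measurable_funX.
Qed.

(** The trace on the hyperboloid of an open box with rational corners. There are
    countably many of them and they refine the topology, so that they play the
    role of a countable basis. *)
Definition rational_box (ab : 'rV[rat]_n.+1 * 'rV[rat]_n.+1) : set H :=
  [set x | forall i, ratr (ab.1 ord0 i) < hcoord x i < ratr (ab.2 ord0 i)].

Lemma measurable_rational_box ab : measurable (rational_box ab).
Proof.
rewrite (_ : rational_box ab = \bigcap_(i in [set: 'I_n.+1])
    ([set: H] `&` (@hcoord R n)^~ i @^-1`
      `]ratr (ab.1 ord0 i), ratr (ab.2 ord0 i)[)).
  apply: fin_bigcap_measurable => // i _.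
  have mc := continuous_measurable_real _ (@continuous_hcoord R n i).
  by apply: mc => //; exact: measurable_itv.
apply/seteqP; split => [t abt i _|t abt i].
  by split=> //=; rewrite in_itv/=; exact: abt.
by have [_ /=] := abt i I; rewrite in_itv.
Qed.

Lemma rational_box_basis U x : open U -> U x ->
  exists ab, rational_box ab x /\ rational_box ab `<=` U.
Proof.
move=> oU Ux.
have [V oV VU] : exists2 V : set 'rV[R]_n.+1, open V & set_val @^-1` V = U.
  by case: oU => V oV <-; exists V.
have Vt : V (set_val x) by move: Ux; rewrite -VU.
have [P Pt PV] := open_nbhs_nbhs (conj oV Vt).
have /choice[ab abP] (i : 'I_n.+1) : exists ab : rat * rat,
    (ratr ab.1 < hcoord x i < ratr ab.2)%R /\
    [set y | ratr ab.1 < y < ratr ab.2]%R `<=` P ord0 i.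
  have /nbhs_ballP[_/posnumP[e] eP] := Pt ord0 i.
  have [a] : exists a : rat, (ratr a : R) \in
      `](hcoord x i - e%:num)%R, hcoord x i[.
    by apply: rat_in_itvoo; rewrite ltrBlDr ltrDl.
  have [b] : exists b : rat, (ratr b : R) \in
      `]hcoord x i, (hcoord x i + e%:num)%R[.
    by apply: rat_in_itvoo; rewrite ltrDl.
  rewrite !in_itv/= => /andP[tb be] /andP[ea at_].
  exists (a, b); split=> /=; first by rewrite at_.
  move=> y /= /andP[ay yb]; apply: eP; rewrite /ball/= ltr_distlC.
  by rewrite (lt_trans ea ay) (lt_trans yb be).
exists (\row_i (ab i).1, \row_i (ab i).2); split.
  by move=> i; rewrite !mxE; have [] := abP i.
move=> y yab; rewrite -VU; apply: PV => i j; rewrite ord1.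
by have [_] := abP j; apply; have := yab j; rewrite !mxE.
Qed.

Lemma open_supp_compl rho : open (~` supp rho).
Proof.
rewrite openE => x /= /existsNP[U /not_implyP[oU /not_implyP[Ux /negP r0]]].
apply: (@filterS _ _ _ U); last exact: open_nbhs_nbhs.
by move=> y Uy /(_ U oU Uy); rewrite (negbTE r0).
Qed.

(** The complement of the support is covered by the countably many rational
    boxes of measure zero. *)
Lemma measure_supp_compl rho : rho (~` supp rho) = 0%E.
Proof.
apply: measure_negligible.
  by apply: open_measurable_hyperboloid; exact: open_supp_compl.
(* The null boxes, enumerated through the countable type of their corners. *)
pose F (m : nat) : set H := if unpickle m is Some ab then
  if rho (rational_box ab) == 0%E then rational_box ab else set0 else set0.
apply: (@negligibleS _ _ _ rho (\bigcup_m F m)); last first.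
  apply: negligible_bigcup => m; rewrite /F.
  case: unpickle => [ab|]; last exact: negligible_set0.
  case: eqP => [r0|_]; last exact: negligible_set0.
  by apply/negligibleP => //; exact: measurable_rational_box.
move=> x /= /existsNP[U /not_implyP[oU /not_implyP[Ux /negP r0]]].
have [ab [xab abU]] := rational_box_basis U x oU Ux.
exists (pickle ab) => //; rewrite /F pickleK ifT//.
rewrite -measure_le0 (le_trans (le_measure rho _ _ abU)) ?inE//.
- exact: measurable_rational_box.
- exact: open_measurable_hyperboloid.
- by rewrite leNgt.
Qed.

Lemma supp_closed rho (C : set H) : closed C -> rho (~` C) = 0%E -> supp rho `<=` C.
Proof.
move=> cC r0 x sx; apply: contrapT => Cx.
by have := sx (~` C) (closed_openC cC) Cx; rewrite r0 ltxx.
Qed.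

Lemma supp_open0 rho U : open U -> rho U = 0%E -> U `<=` ~` supp rho.
Proof. by move=> oU r0 x Ux /(_ U oU Ux); rewrite r0 ltxx. Qed.

Lemma supp_neq0 rho : supp rho !=set0.
Proof.
apply/set0P/eqP => s0; have := measure_supp_compl rho.
by rewrite s0 setC0 probability_setT => /eqP; rewrite onee_eq0.
Qed.

End BorelHyperboloid.

(** * Integrands bounded from below *)
Section LowerBoundedIntegrands.
Local Open Scope ereal_scope.
Context {d} {T : measurableType d} {R : realType}.
Variable mu : {finite_measure set T -> \bar R}.
Implicit Types f g : T -> \bar R.

(** On a finite measure space a function bounded from below is integrable as
    soon as its integral is not [+oo]. *)
Lemma integrable_lower_bounded f (c : R) : measurable_fun setT f ->
  (forall x, c%:E <= f x) -> \int[mu]_x f x < +oo -> mu.-integrable setT f.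
Proof.
move=> mf cf foo.
have mp := measurable_funepos mf; have mn := measurable_funeneg mf.
have cst_int := finite_measure_integrable_cst mu `|c|%R measurableT.
have fn : mu.-integrable setT f^\-.
  apply: (le_integrable measurableT mn _ cst_int) => x _ /=.
  rewrite (gee0_abs (funeneg_ge0 f x)) normr_id funenegE ge_max.
  rewrite lee_fin normr_ge0 andbT -(oppeK `|c|%:E) leeN2 -EFinN.
  by apply: le_trans (cf x); rewrite lee_fin lerNl ler_normr lexx orbT.
have nfin := integrable_fin_num measurableT fn.
have fp : \int[mu]_x f^\+ x < +oo.
  move: foo; rewrite integralE; apply: contraTT; rewrite -!leNgt !leye_eq => /eqP ->.
  by rewrite -(fineK nfin) -EFinN addye.
have fpi : mu.-integrable setT f^\+.
  apply/integrableP; split=> //; apply: le_lt_trans fp.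
  by rewrite le_eqVlt; apply/orP; left; apply/eqP/eq_integral => x _; rewrite gee0_abs.
rewrite [f]funeposneg; exact: integrableB.
Qed.

(** Two functions compared almost everywhere one way and in the integral the
    other way agree almost everywhere. The integrability of g is not assumed: a lower
    bound suffices. *)
Lemma ae_eq_integral_le f g (c : R) :
  mu.-integrable setT f -> measurable_fun setT g -> (forall x, c%:E <= g x) ->
  (\forall x \ae mu, g x <= f x) -> \int[mu]_x f x <= \int[mu]_x g x ->
  \forall x \ae mu, g x = f x.
Proof.
move=> fi mg cg gf fg; have mf := measurable_int _ fi.
(* Off a null set N everything is finite and [f - g] is nonnegative. *)
pose P x := g x <= f x /\ f x \is a fin_num.
have [N [mN N0 Nfg]] : \forall x \ae mu, P x.
  apply: filterS2 gf (integrable_ae measurableT fi) => x gfx /(_ I) ffin.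
  by split.
pose D := ~` N; have mD : measurable D by exact: measurableC.
have DP x : D x -> P x by move=> Dx; apply: contrapT => /Nfg.
have aeD : \forall x \ae mu, D x by exists N; split=> // x; rewrite /D/= notK.
have fD : mu.-integrable D f by exact: integrableS fi.
have mgD : measurable_fun D g by exact: measurable_funTS.
have gD : mu.-integrable D g.
  have sD : mu.-integrable D ((abse \o f) \+ (EFin \o cst `|c|%R)).
    apply: integrableD => //; first exact: integrable_abse.
    exact: finite_measure_integrable_cst.
  apply: (le_integrable mD mgD _ sD) => x /DP[gfx ffin] /=.
  move: gfx (cg x); rewrite -(fineK ffin); case: (g x) => [y| |]//=.
  rewrite !lee_fin => yf cy; rewrite [leRHS]ger0_norm ?addr_ge0//.
  rewrite ler_norml; apply/andP; split.
    rewrite lerNl (le_trans _ (_ : `|c| <= _)%R) ?lerDr//.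
    by rewrite (le_trans (_ : - y <= - c)%R) ?lerN2// -normrN ler_norm.
  by rewrite (le_trans yf)// (le_trans (ler_norm _))// lerDl.
have fE : \int[mu]_x f x = \int[mu]_(x in D) f x.
  by rewrite (negligible_integral mN measurableT fi N0) setTD.
have gE : \int[mu]_x g x = \int[mu]_(x in D) g x.
  rewrite [RHS]integral_mkcond; apply: ae_eq_integral => //.
    by apply/(measurable_restrictT _ mD).
  by apply: filterS aeD => x Dx _; rewrite patchE mem_set.
have h0 x : D x -> 0 <= f x - g x.
  by move=> /DP[gfx ffin]; rewrite sube_ge0// ffin ?orbT.
have : ae_eq mu D (f \- g) (cst 0).
  apply/ae_eq_integral_abs => //.
    by apply: emeasurable_funB => //; exact: measurable_funTS.
  have -> : \int[mu]_(x in D) `|(f \- g) x| = \int[mu]_(x in D) (f \- g) x.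
    by apply: eq_integral => x /[!inE] Dx; rewrite gee0_abs// h0.
  apply/eqP; rewrite eq_le integral_ge0// andbT integralB//.
  by rewrite sube_le0 -fE -gE.
move=> fg0; apply: filterS2 aeD fg0 => z Dz /(_ Dz) /= /eqP.
have [gfz ffin] := DP z Dz.
move: (cg z) gfz; rewrite -(fineK ffin); move: (fine (f z)) => v.
case: (g z) => [y| |]//= _ _.
by rewrite -EFinB eqe subr_eq0 => /eqP ->.
Qed.
End LowerBoundedIntegrands.

(** * Energy of measures on the hyperboloid *)
Section Energy.
Context {R : realType} {n : nat}.
Local Notation H := (hyperboloid R n).
Variables (K : R -> \bar R) (Kmin : R).
Hypothesis K_ge : forall t : R, 0 <= t -> (Kmin%:E <= K t)%E.
Hypothesis K_lsc : lower_semicontinuous (K : subspace `[0, +oo[%classic -> \bar R).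
Implicit Types (x y : H) (rho nu : probability H R).

Lemma measurable_potential :
  measurable_fun setT (fun z : H * H => K (hdist z.1 z.2)).
Proof.
pose I0 : set (measurableTypeR R) := `[0, +oo[%classic.
have mI : measurable I0 by exact: measurable_itv.
apply: (measurable_comp mI _ _ measurable_hdist).
  by move=> _ [z _ <-]; rewrite /I0/= in_itv/= hdist_ge0.
apply: (measurability _ (ErealGenOInfty.measurableE R)).
move=> /= _ [_ [a ->]] <-; apply: open_measurable_subspace => //.
by rewrite preimage_itvoy; move/lower_semicontinuousP : K_lsc; exact.
Qed.

Lemma integrable_potential rho :
  (\int[rho \x rho]_z K (hdist z.1 z.2) < +oo)%E ->
  ((rho \x rho)%E).-integrable setT (fun z : H * H => K (hdist z.1 z.2)).
Proof.
move=> foo.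
apply: (integrable_lower_bounded ((rho \x rho)%E : probability _ R) _ Kmin) => //.
  exact: measurable_potential.
by move=> z; apply: K_ge; exact: hdist_ge0.
Qed.

Lemma half_lt_pinfty (a b : \bar R) : (2^-1%:E * a < b -> a < +oo)%E.
Proof.
case: a => [a| |]//=; rewrite ?ltry// gt0_muley ?lte_fin ?invr_gt0//.
by rewrite ltNge leey.
Qed.

Lemma energy_le_integral rho nu : (energy K rho <= energy K nu)%E ->
  (\int[rho \x rho]_z K (hdist z.1 z.2) <= \int[nu \x nu]_z K (hdist z.1 z.2))%E.
Proof. by rewrite /energy lee_pmul2l// lte_fin invr_gt0. Qed.

Lemma hball_vertexE (r : R) : 0 <= r ->
  hball (vertex R n) r = [set x | 0 < cosh r - hcoord x ord0].
Proof.
by move=> r0; rewrite hballE//; apply/seteqP; split=> x /=; rewrite subr_gt0.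
Qed.

Lemma open_hball (r : R) : 0 <= r -> open (hball (vertex R n) r).
Proof.
move=> r0; rewrite hball_vertexE//; apply: open_halfspace.
by apply: continuous_subr; [exact: cst_continuous|exact: continuous_hcoord].
Qed.

(** If some probability rho has finite energy, then so does one carried by any
    prescribed ball around the vertex: condition rho on a small neighbourhood of
    a point c of its support, and move c to the vertex by an isometry. *)
Lemma finite_energy_competitor (rho : probability H R) (r : R) : 0 < r ->
  (\int[rho \x rho]_z K (hdist z.1 z.2) < +oo)%E ->
  exists2 nu : probability H R, prob_in_ball r nu &
    (\int[nu \x nu]_z K (hdist z.1 z.2) < +oo)%E.
Proof.
move=> r0 rhooo; have [c sc] := supp_neq0 rho.
have [F [cF FK Fc]] := reflection_to_vertex c.
pose B := hball (vertex R n) r; pose U := F @^-1` B.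
have oB : open B by exact: open_hball (ltW r0).
have oU : open U by move/continuousP : cF; exact.
have mU := open_measurable_hyperboloid _ oU.
have Uc : U c by rewrite /U/= /B hballE ?ltW//= Fc -cosh0 cosh_mono.
have mF := continuous_measurable_hyperboloid _ cF.
pose f (z : H * H) := K (hdist z.1 z.2).
have mf : measurable_fun setT f := measurable_potential.
have [kap kapU kapE] := integral_conditional rho U f^\+%E mU (sc U oU Uc)
  (measurable_funepos mf) (funepos_ge0 f).
have [nu [nuE nuI]] := pushforward_probability kap F mF.
exists nu.
  apply: supp_closed; first exact: closed_closure.
  rewrite nuE; apply/eqP; rewrite -measure_le0 -kapU le_measure ?inE//.
  - rewrite -[X in measurable X]setTI; apply: mF => //.
    apply: open_measurable_hyperboloid; apply: closed_openC.
    exact: closed_closure.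
  - exact: measurableC.
  - by move=> x /= nx Ux; apply: nx; exact: subset_closure.
rewrite nuI//.
have -> : (\int[kap \x kap]_z K (hdist (F z.1, F z.2).1 (F z.1, F z.2).2) =
  \int[kap \x kap]_z f z)%E.
  by apply: eq_integral => z _; rewrite /f !hdistE FK.
apply: le_lt_trans (_ : (\int[kap \x kap]_z f^\+ z < +oo)%E).
  rewrite integralE geeDl// oppe_le0.
  by apply: integral_ge0 => z _; exact: funeneg_ge0.
apply: le_lt_trans kapE _; apply: lte_mul_pinfty => //.
  by rewrite lee_fin sqr_ge0.
have := integrable_funepos measurableT (integrable_potential _ rhooo).
by move=> /integrable_lty; exact.
Qed.

(** Let an isometry F move the part of a minimizer lying in P, keeping it in the
    ball. If every distance between the moved part and the part left in place
    changes so as to lower the potential, then one of the two parts is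
    negligible: otherwise the image measure would have a smaller energy. *)
Lemma minimizer_no_split rho (r : R) (P : set H) (F : H -> H) :
  energy_minimizer K (prob_in_ball r) rho ->
  (\int[rho \x rho]_z K (hdist z.1 z.2) < +oo)%E ->
  measurable P -> continuous F -> (forall x y, mink (F x) (F y) = mink x y) ->
  (forall x, supp rho x -> P x -> closure (hball (vertex R n) r) (F x)) ->
  (forall x y, supp rho x -> supp rho y -> P x -> ~ P y ->
    (K (hdist (F x) y) < K (hdist x y))%E) ->
  rho P = 0%E \/ rho (~` P) = 0%E.
Proof.
move=> [rho_ball rho_min] rhooo mP cF FK FP FPN.
have mF := continuous_measurable_hyperboloid _ cF.
pose C := closure (hball (vertex R n) r).
have oC : open (~` C) by apply: closed_openC; exact: closed_closure.
pose T x := if x \in P then F x else x.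
have mT : measurable_fun setT T.
  apply: measurable_fun_ifT => //.
  apply: (measurable_fun_bool true); rewrite setTI.
  rewrite (_ : _ @^-1` _ = P)//.
  by apply/seteqP; split=> x /=; [exact: set_mem|exact: mem_set].
have [nu [nuE nuI]] := pushforward_probability rho T mT.
pose f (z : H * H) := K (hdist z.1 z.2).
have mf : measurable_fun setT f := measurable_potential.
pose g (z : H * H) := f (T z.1, T z.2).
have mg : measurable_fun setT g.
  by apply: (measurableT_comp mf); exact: measurable_fun_map_pair.
have nu_ball : prob_in_ball r nu.
  apply: supp_closed; first exact: closed_closure.
  rewrite nuE; apply/eqP; rewrite -measure_le0 -(measure_supp_compl rho).
  rewrite le_measure ?inE//.
  - rewrite -[X in measurable X]setTI; apply: mT => //.
    exact: open_measurable_hyperboloid.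
  - by apply: open_measurable_hyperboloid; exact: open_supp_compl.
  move=> x /= nTx sx; apply: nTx; rewrite /T; case: ifPn => xP.
    by apply: FP => //; exact: set_mem xP.
  exact: rho_ball.
have le_fg : (\int[rho \x rho]_z f z <= \int[rho \x rho]_z g z)%E.
  by have := energy_le_integral _ _ (rho_min _ nu_ball); rewrite [leRHS]nuI.
have hdC x y : hdist x y = hdist y x by rewrite !hdistE minkC.
pose S := supp rho.
have mS : measurable (~` S).
  by apply: open_measurable_hyperboloid; exact: open_supp_compl.
have rS : rho (~` S) = 0%E := measure_supp_compl rho.
have aeS : \forall z \ae (rho \x rho)%E, S z.1 /\ S z.2.
  have r1 : ((rho \x rho) (~` S `*` setT) = 0)%E.
    by rewrite product_measure1E//= rS mul0e.
  have r2 : ((rho \x rho) (setT `*` ~` S) = 0)%E.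
    by rewrite product_measure1E//= rS mule0.
  have nS1 : ((rho \x rho)%E).-negligible (~` S `*` setT).
    by exists (~` S `*` setT); split=> //; exact: measurableX.
  have nS2 : ((rho \x rho)%E).-negligible (setT `*` ~` S).
    by exists (setT `*` ~` S); split=> //; exact: measurableX.
  apply: negligibleS (negligibleU nS1 nS2) => z /= /not_andP[?|?]; [by left|by right].
have gf : \forall z \ae (rho \x rho)%E, (g z <= f z)%E.
  apply: filterS aeS => -[x y] /= [Sx Sy]; rewrite /g /f/= /T.
  case: ifPn => xP; case: ifPn => yP.
  - by rewrite !hdistE FK.
  - by apply/ltW/FPN => //; [exact: set_mem|rewrite -notin_setE].
  - rewrite hdC (hdC x).
    by apply/ltW/FPN => //; [exact: set_mem|rewrite -notin_setE].
  - by [].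
have fge z : (Kmin%:E <= g z)%E by apply: K_ge; exact: hdist_ge0.
have gEf : \forall z \ae (rho \x rho)%E, g z = f z.
  exact: (ae_eq_integral_le ((rho \x rho)%E : probability _ R) f g Kmin
    (integrable_potential _ rhooo)).
have : ((rho \x rho) (P `*` ~` P) = 0)%E.
  apply/negligibleP; first by apply: measurableX => //; exact: measurableC.
  have [N [mN N0 NE]] : \forall z \ae (rho \x rho)%E, ~ (P `*` ~` P) z.
    apply: filterS2 gEf aeS => -[x y] /= gfE [Sx Sy] [Px nPy].
    have := FPN x y Sx Sy Px nPy; move: gfE; rewrite /g /f/= /T.
    by rewrite (mem_set Px) (memNset nPy) => ->; rewrite ltxx.
  by exists N; split=> // z Pz; apply: NE => /=; exact.
rewrite product_measure1E//; last exact: measurableC.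
by move=> /eqP; rewrite mule_eq0 => /orP[] /eqP ->; [left|right].
Qed.

End Energy.

(** * Closing a gap with a boost *)
Section Gap.
Context {R : realType} {n : nat}.
Local Notation H := (hyperboloid R n).
Implicit Types x y : H.

(** The half space where [hproj k] lies beyond b on the side [sgn] is cut out by
    the sign of [x_k cosh b - x_0 sinh b = hrad k x * sinh (hproj k x - b)]. *)
Lemma open_hproj_side (k : 'I_n) (sgn b : R) : sgn = 1 \/ sgn = -1 ->
  open [set x : H | 0 < sgn * (hproj k x - b)].
Proof.
move=> sgnE; have sinhE s : (0 < sgn * sinh s) = (0 < sgn * s).
  by case: sgnE => ->; [rewrite !mul1r|rewrite !mulN1r -sinhN]; rewrite sinh_gt0.
have <- : [set x : H | 0 <
    hcoord x (lift ord0 k) * (sgn * cosh b) - hcoord x ord0 * (sgn * sinh b)] =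
    [set x : H | 0 < sgn * (hproj k x - b)].
  apply/seteqP; split=> x /=; rewrite (hcoord0_polar k) hcoordk_polar;
    set u := hproj k x; have h0 := hrad_gt0 k x;
    have -> : hrad k x * sinh u * (sgn * cosh b) - hrad k x * cosh u * (sgn * sinh b)
      = hrad k x * (sgn * sinh (u - b)) by rewrite sinhD sinhN coshN; ring.
  - by rewrite (pmulr_rgt0 _ h0) sinhE.
  - by rewrite (pmulr_rgt0 _ h0) sinhE.
apply: open_halfspace; apply: continuous_subr;
  by apply: continuous_mulr_cst; exact: continuous_hcoord.
Qed.

(** A boost by t towards the vertex keeps a point in the closed ball when its
    projection exceeds t on the side [sgn]. Here [closure] is the topological
    closure of the open ball, hence the approximation of x by points of the ball
    whose projection still exceeds [t / 2]. *)
Lemma boost_inward (k : 'I_n) (sgn t r : R) (F : H -> H) x :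
  sgn = 1 \/ sgn = -1 -> 0 < t -> 0 <= r -> continuous F ->
  (forall y, hcoord (F y) ord0 = hrad k y * cosh (hproj k y - sgn * t)) ->
  t < sgn * hproj k x -> closure (hball (vertex R n) r) x ->
  closure (hball (vertex R n) r) (F x).
Proof.
move=> sgnE t0 r0 cF FE tx cx W WFx.
(* On this neighbourhood [|u - sgn * t| <= |u|] for [u = hproj k y]. *)
have Vx : nbhs x [set y | 0 < sgn * (hproj k y - sgn * (t / 2))].
  apply: open_nbhs_nbhs; split; first exact: open_hproj_side.
  by case: sgnE tx => -> /= ?; lra.
have Wx : nbhs x (F @^-1` W) by exact: cF.
have [y [By [FWy Vy]]] := cx _ (filterI Wx Vx).
exists (F y); split=> //; move: By; rewrite hballE//= FE (hcoord0_polar k).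
apply: le_lt_trans; rewrite ler_pM2l ?hrad_gt0//; apply: cosh_le.
move: Vy => /=; case: sgnE => -> ?.
  rewrite [leRHS]ger0_norm; last by lra.
  by rewrite ler_norml; apply/andP; split; lra.
rewrite [leRHS]ler0_norm; last by lra.
by rewrite ler_norml; apply/andP; split; lra.
Qed.

(** The part of the support beyond a, on the side [sgn] away from the vertex, is
    boosted by R6 towards the other part. The projections of the two parts, more
    than [2 R6] apart at first, remain more than R6 apart, hence so do the points,
    and beyond R6 the potential is strictly increasing. *)
Lemma one_sided_support (K : R -> \bar R) (Kmin R6 r a sgn : R)
    (rho : probability H R) (k : 'I_n) :
  (forall t : R, 0 <= t -> (Kmin%:E <= K t)%E) ->
  lower_semicontinuous (K : subspace `[0, +oo[%classic -> \bar R) ->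
  0 < R6 -> (forall s t : R, R6 <= s -> s < t -> (K s < K t)%E) -> 0 <= r ->
  energy_minimizer K (prob_in_ball r) rho ->
  (\int[rho \x rho]_z K (hdist z.1 z.2) < +oo)%E ->
  (forall x, supp rho x -> R6 < `|hproj k x - a|) ->
  sgn = 1 \/ sgn = -1 -> 0 <= sgn * a ->
  (forall x, supp rho x -> sgn * (hproj k x - a) <= 0) \/
  (forall x, supp rho x -> 0 <= sgn * (hproj k x - a)).
Proof.
move=> K_ge K_lsc R6_gt0 K_incr r0 rho_min rhooo gap sgnE sa.
have [F [cF FK F0 Fmink]] := boost k (- (sgn * R6)).
pose P := [set x : H | 0 < sgn * (hproj k x - a)].
have oP : open P by exact: open_hproj_side.
have farP x : supp rho x -> P x -> R6 < sgn * (hproj k x - a).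
  move=> /gap; rewrite /P/=; case: sgnE => -> + h.
    by rewrite gtr0_norm; lra.
  by rewrite ltr0_norm; lra.
have farN x : supp rho x -> ~ P x -> sgn * (hproj k x - a) < - R6.
  move=> /gap; rewrite /P/= => + /negP; rewrite -leNgt; case: sgnE => -> + h.
    by rewrite ler0_norm; lra.
  by rewrite ger0_norm; lra.
have [||r1|r1] := minimizer_no_split K Kmin K_ge K_lsc rho r P F rho_min rhooo
  (open_measurable_hyperboloid _ oP) cF FK.
- move=> x sx Px; apply: (boost_inward k sgn R6) => //.
    by have := farP x sx Px; case: sgnE sa => -> ? ?; lra.
  by have [+ _] := rho_min; exact.
- move=> x y sx sy Px nPy; have hx := farP x sx Px; have hy := farN y sy nPy.
  have hF : cosh R6 <= mink (F x) y.
    rewrite Fmink (le_trans _ (mink_perp_ub _ _ _ _))// cosh_le//.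
    rewrite [leLHS]gtr0_norm//; case: sgnE hx hy => -> hx hy.
      by rewrite ger0_norm; lra.
    by rewrite ler0_norm; lra.
  apply: K_incr.
    by rewrite leNgt hdistE acosh_ltl ?mink_ge1 ?ltW// -leNgt.
  rewrite !hdistE; apply: acosh_lt; first exact: mink_ge1.
  rewrite Fmink (mink_polar k x y) ltrD2r.
  rewrite (ltr_pM2l (mulr_gt0 (hrad_gt0 k x) (hrad_gt0 k y))).
  apply: cosh_lt; case: sgnE hx hy => -> hx hy.
    by rewrite !gtr0_norm; lra.
  by rewrite !ltr0_norm; lra.
- left=> x sx; rewrite leNgt; apply/negP => Px.
  exact: (supp_open0 _ _ oP r1 _ Px sx).
right=> x sx; rewrite leNgt; apply/negP => Nx.
pose Q := [set x : H | 0 < - sgn * (hproj k x - a)].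
have oQ : open Q.
  by apply: open_hproj_side; case: sgnE => ->; [right|left; rewrite opprK].
have rQ : rho Q = 0%E.
  apply/eqP; rewrite -measure_le0 -r1 le_measure ?inE//.
  - exact: open_measurable_hyperboloid.
  - by apply: measurableC; exact: open_measurable_hyperboloid.
  by move=> y; rewrite /Q /P/= => + h; lra.
by apply: (supp_open0 _ _ oQ rQ x _ sx); rewrite /Q/=; lra.
Qed.

End Gap.

Theorem lemma4p3 (R : realType) (n : nat) (K : R -> \bar R)
    (Kmin : R) (Kinf : \bar R) (R6 : R)
    (Kmin_lt0 : Kmin < 0)
    (K_ge : forall t : R, 0 <= t -> (Kmin%:E <= K t)%E)
    (K_locint : forall r : R, 0 < r ->
      (\int[@hvolume R n]_(x in hball (vertex R n) r)
         `|K (hdist x (vertex R n))| < +oo)%E)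
    (K_lim : K t @[t --> +oo%R] --> Kinf)
    (K_unstable : exists rho : probability (hyperboloid R n) R,
      (energy K rho < 2^-1%:E * Kinf)%E)
    (K_lsc : lower_semicontinuous (K : subspace `[0, +oo[%classic -> \bar R))
    (R6_gt0 : 0 < R6)
    (K_incr : forall s t : R, R6 <= s -> s < t -> (K s < K t)%E)
    (r : R) (r_ge0 : 0 <= r) (rho_r : probability (hyperboloid R n) R)
    (rho_r_min : energy_minimizer K (prob_in_ball r) rho_r)
    (k : 'I_n) (a : R)
    (gap : hproj k @^-1` `[a - R6, a + R6] `<=` ~` supp rho_r) :
  hproj k @^-1` `]-oo, a - R6] `<=` ~` supp rho_r \/
  hproj k @^-1` `[a + R6, +oo[ `<=` ~` supp rho_r.
Proof.
have rho_ball := rho_r_min.1.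
have r_gt0 : 0 < r.
  rewrite lt_neqAle r_ge0 andbT; apply/eqP => r0.
  have [x sx] := supp_neq0 rho_r.
  have /= := rho_ball x sx; rewrite -r0.
  rewrite (_ : hball _ _ = set0) ?closure0//.
  apply/seteqP; split=> // y; rewrite /hball/= => yv.
  by have := hdist_ge0 y (vertex R n); lra.
have [rho0 rho0_lt] := K_unstable.
have rho0_fin : (\int[rho0 \x rho0]_z K (hdist z.1 z.2) < +oo)%E.
  exact: half_lt_pinfty rho0_lt.
have [nu nu_ball nu_fin] :=
  finite_energy_competitor K Kmin K_ge K_lsc rho0 r r_gt0 rho0_fin.
have rho_fin : (\int[rho_r \x rho_r]_z K (hdist z.1 z.2) < +oo)%E.
  by apply: le_lt_trans nu_fin; apply: energy_le_integral; exact: rho_r_min.2.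
have far x : supp rho_r x -> R6 < `|hproj k x - a|.
  move=> sx; rewrite ltNge; apply/negP => near; apply: (gap x _ sx) => /=.
  by move: near; rewrite in_itv/= ler_norml => /andP[? ?]; apply/andP; split; lra.
have side s := one_sided_support K Kmin R6 r a s rho_r k K_ge K_lsc R6_gt0 K_incr
  r_ge0 rho_r_min rho_fin far.
suff [le_a|ge_a] : (forall x, supp rho_r x -> hproj k x <= a) \/
                   (forall x, supp rho_r x -> a <= hproj k x).
- by right=> x /=; rewrite in_itv/= andbT => xa /le_a; lra.
- by left=> x /=; rewrite in_itv/= => xa /ge_a; lra.
have [a0|a0] := leP 0 a.
  case: (side 1 (or_introl erefl) _) => [|h|h]; first by rewrite mul1r.
  - by left=> x /h; rewrite mul1r subr_le0.
  - by right=> x /h; rewrite mul1r subr_ge0.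
case: (side (-1) (or_intror erefl) _) => [|h|h]; first by lra.
- by right=> x /h; lra.
- by left=> x /h; lra.
Qed.
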